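(* For integers $\ell,m\ge1$ and a matrix $A\in\mathbb F_2^{m\times\ell}$ define $c_A:\mathbb F_2^\ell\times\mathbb F_2^m\to\{0,1\}$ by $c_A(z,y)=\mathbf 1[Az=y]$, and let $\mathcal C_{\ell,m}=\{c_A:A\in\mathbb F_2^{m\times\ell}\}$. Then there are absolute constants $\kappa,K>0$ such that for all $\ell,m\ge1$ $$\kappa\,2^{m/2}\le\mathsf Q(\mathcal C_{\ell,m})\le K\,2^{m/2}\qquad\text{and}\qquad \mathsf R(\mathcal C_{\ell,m})\ge\kappa\,2^m\ell .$$ In particular, taking $\ell=m$, so that the domain of $\mathcal C_{m,m}$ has size $N=2^{2m}$, there is an absolute constant $\kappa'>0$ such that $\mathsf R(\mathcal C_{m,m})\ge\kappa'\,\mathsf Q(\mathcal C_{m,m})^2\log N$ for all $m\ge1$.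
   Context: A concept class over a finite domain $X$ of size $N$ is a set $\mathcal C$ of functions $c:X\to\{0,1\}$. Exact learning with membership queries: an unknown target $c^*\in\mathcal C$ is accessed by queries and the learner must output $c^*$. A classical query at $x\in X$ returns $c^*(x)$; queries may be adaptive. $\mathsf R(\mathcal C)$ is the minimum worst-case number of queries of a randomized learner that, for every $c^*\in\mathcal C$, outputs $c^*$ with probability at least $2/3$. $\mathsf Q(\mathcal C)$ is the bounded-error quantum query complexity: the minimum number of applications of the unitary $|x,b\rangle\mapsto|x,b\oplus c^*(x)\rangle$ (interleaved with arbitrary target-independent unitaries, followed by a measurement) needed by a quantum algorithm that outputs $c^*$ with probability at least $2/3$ for every $c^*\in\mathcal C$. Logarithms are base 2. *)

(* Defs.v *)
From HB Require Import structures.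
From mathcomp Require Import all_boot all_order all_algebra.
From mathcomp Require Import complex.
From mathcomp Require Import all_classical all_reals all_analysis.

Set Implicit Arguments.
Unset Strict Implicit.
Unset Printing Implicit Defensive.

Import Order.TTheory GRing.Theory Num.Theory.
Local Open Scope classical_set_scope.
Local Open Scope ring_scope.

Definition concept (X : finType) := {ffun X -> bool}.

(* The minimum of a set of query counts, read as +oo if the set is empty. *)
Definition min_queries (R : realType) (P : nat -> Prop) : \bar R :=
  ereal_inf [set (n%:R)%:E | n in [set n | P n]].

(** * Randomized learners *)

(* Deterministic adaptive learners: [Ask x t0 t1] queries [x] and continues as
   [t0] on answer 0 and as [t1] on answer 1. *)
Inductive dtree (X : finType) : Type :=
| Answer of concept X
| Ask of X & dtree X & dtree X.

Fixpoint dtree_output (X : finType) (t : dtree X) (c : concept X) : concept X :=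
  match t with
  | Answer h => h
  | Ask x t0 t1 => dtree_output (if c x then t1 else t0) c
  end.

Fixpoint dtree_queries (X : finType) (t : dtree X) (c : concept X) : nat :=
  match t with
  | Answer _ => 0%N
  | Ask x t0 t1 => (dtree_queries (if c x then t1 else t0) c).+1
  end.

(* A probability distribution on deterministic learners.  Finite support is no
   restriction: for a given bound on the number of queries over a finite [X]
   there are only finitely many learners up to unreachable branches. *)
Record rlearner (R : realType) (X : finType) := RLearner {
  rl_seed : finType;
  rl_prob : rl_seed -> R;
  rl_tree : rl_seed -> dtree X;
  rl_prob_ge0 : forall s, 0 <= rl_prob s;
  rl_prob_sum1 : \sum_s rl_prob s = 1
}.
Arguments rl_prob {R X} r _.
Arguments rl_tree {R X} r _.

Definition rl_success (R : realType) (X : finType) (L : rlearner R X)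
    (c : concept X) : R :=
  \sum_(s | dtree_output (rl_tree L s) c == c) rl_prob L s.

Definition rand_learnable (R : realType) (X : finType)
    (CC : {set concept X}) (q : nat) : Prop :=
  exists L : rlearner R X, forall c, c \in CC ->
    (forall s, (dtree_queries (rl_tree L s) c <= q)%N) /\
    2 / 3 <= rl_success L c.

Definition rand_complexity (R : realType) (X : finType)
    (CC : {set concept X}) : \bar R :=
  min_queries R (rand_learnable R CC).

(** * Quantum learners *)

(* Labels |x, b, w> of the computational basis, with [w] in a workspace [W].
   Vectors and matrices are indexed by basis labels through
   [enum_rank] / [enum_val]. *)
Definition qbasis (X W : finType) : finType := (X * bool * W)%type.

Definition ket (K : numClosedFieldType) (T : finType) (s : T) : 'cV[K]_#|T| :=
  delta_mx (enum_rank s) 0.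

Definition query_label (X W : finType) (c : concept X) (s : qbasis X W) :
    qbasis X W :=
  let: (x, b, w) := s in (x, b (+) c x, w).

(* |x, b, w> |-> |x, b (+) c x, w>, acting on column vectors. *)
Definition query_mx (K : numClosedFieldType) (X W : finType) (c : concept X) :
    'M[K]_#|qbasis X W| :=
  \matrix_(i, j) (enum_val i == query_label c (enum_val j))%:R.

(* Since the unitaries and the workspace are arbitrary, it is no restriction to
   start in a basis state and to end with a computational-basis measurement
   whose outcome is decoded by [ql_out]. *)
Record qlearner (K : numClosedFieldType) (X : finType) := QLearner {
  ql_work : finType;
  ql_init : qbasis X ql_work;
  ql_unitary : nat -> 'M[K]_#|qbasis X ql_work|;
  ql_out : qbasis X ql_work -> concept X;
  ql_unitaryP : forall k, ql_unitary k \is unitarymx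
}.
Arguments ql_init {K X} q.
Arguments ql_unitary {K X} q _.
Arguments ql_out {K X} q _.

(* U_q O_c U_(q-1) O_c ... U_1 O_c U_0 |init> *)
Fixpoint ql_state (K : numClosedFieldType) (X : finType) (L : qlearner K X)
    (c : concept X) (q : nat) : 'cV[K]_#|qbasis X (ql_work L)| :=
  match q with
  | 0 => ql_unitary L 0 *m ket K (ql_init L)
  | q'.+1 => ql_unitary L q *m (query_mx K (ql_work L) c *m ql_state L c q')
  end.

Definition ql_success (K : numClosedFieldType) (X : finType)
    (L : qlearner K X) (c : concept X) (q : nat) : K :=
  \sum_(s | ql_out L s == c) `|ql_state L c q (enum_rank s) 0| ^+ 2.

(* The inequality is in [R[i]], whose order relates only numbers with the same
   imaginary part; both sides are real. *)
Definition quantum_learnable (R : realType) (X : finType)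
    (CC : {set concept X}) (q : nat) : Prop :=
  exists L : qlearner R[i] X, forall c, c \in CC -> 2 / 3 <= ql_success L c q.

Definition quantum_complexity (R : realType) (X : finType)
    (CC : {set concept X}) : \bar R :=
  min_queries R (quantum_learnable R CC).

(** * The concept class of graphs of linear maps *)

Definition lin_domain (l m : nat) : finType := ('cV['F_2]_l * 'cV['F_2]_m)%type.

Definition lin_concept (l m : nat) (A : 'M['F_2]_(m, l)) :
    concept (lin_domain l m) :=
  [ffun zy => A *m zy.1 == zy.2].

Definition lin_class (l m : nat) : {set concept (lin_domain l m)} :=
  [set lin_concept A | A : 'M['F_2]_(m, l)]%SET.

Definition log2 (R : realType) (x : R) : R := ln x / ln 2.

(* Main.v *)
Require Import Defs.
From mathcomp Require Import all_boot all_order all_algebra.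
From mathcomp Require Import complex.
From mathcomp Require Import all_classical all_reals all_analysis.
From mathcomp Require Import ring lra zify.

Set Implicit Arguments.
Unset Strict Implicit.
Unset Printing Implicit Defensive.

Import Order.TTheory GRing.Theory Num.Theory.
Local Open Scope ring_scope.

(** Randomized lower bound: a decision tree must reach a separate leaf for every
    matrix it identifies.  A branch with answer 1 reveals the image of a new
    vector, which happens at most l times before the matrix is known, so at most
    sum_(j <= l) C(q, j) matrices are identified with q queries; for q below a
    small multiple of 2^m l this is less than 2/3 of 2^(m l).

    Quantum lower bound: the matrices with first column v and zeros elsewhere
    encode the search for v among 2^m items, to which the hybrid argument
    applies.

    Quantum upper bound: the rows are learned one at a time, without error.  Once
    the first j rows are known, A z has 2^(m-j) possible values, and exact
    amplitude amplification computes it for a superposition of all z with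
    O(2^((m-j)/2)) queries; the phase (-1)^((A z)_j) followed by uncomputation
    leaves a state that determines row j (Bernstein-Vazirani).  The costs form a
    geometric series.  The states are real, and families of states with the same
    Gram matrix are related by an orthogonal matrix, so the unitaries between
    queries need not be written down. *)

(** * Randomized lower bound *)

Lemma lin_concept_inj l m : injective (@lin_concept l m).
Proof.
move=> A B /ffunP eqAB; suff AB (z : 'cV_l) : A *m z = B *m z.
  by apply/matrixP => i j; have /matrixP/(_ i 0) := AB (delta_mx j 0); rewrite -!colE !mxE.
by have := eqAB (z, A *m z); rewrite !ffunE /= eqxx => /esym/eqP.
Qed.

(** This is the intersection of the kernels of all [A - B], hence a subspace; its codimension
    measures how much about [S] is still undetermined. *)
Definition agree_set l m (S : {set 'M['F_2]_(m, l)}) : {set 'cV['F_2]_l} :=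
  [set z | [forall A in S, forall B in S, A *m z == B *m z]].

Lemma agree_setP l m (S : {set 'M['F_2]_(m, l)}) z :
  reflect {in S &, forall A B, A *m z = B *m z} (z \in agree_set S).
Proof.
rewrite inE; apply: (iffP forall_inP) => [h A B AS BS | h A AS].
  by have /forall_inP/(_ B BS)/eqP := h A AS.
by apply/forall_inP => B BS; apply/eqP; apply: h.
Qed.

Lemma agree_setS l m (S T : {set 'M['F_2]_(m, l)}) :
  S \subset T -> agree_set T \subset agree_set S.
Proof.
move=> /fintype.subsetP sub; apply/fintype.subsetP => z /agree_setP h.
by apply/agree_setP => A B /sub AT /sub BT; apply: h.
Qed.

(** After conditioning on [A *m z = y] the agreement set contains both the old one and its translate
    by [z], which are disjoint because [z] lies outside the old subspace. *)
Lemma agree_set_double l m (S : {set 'M['F_2]_(m, l)}) z y :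
  z \notin agree_set S ->
  (2 * #|agree_set S| <= #|agree_set [set A in S | A *m z == y]|)%N.
Proof.
set D := agree_set S => zD.
have sub1 : D \subset agree_set [set A in S | A *m z == y].
  by apply: agree_setS; apply/fintype.subsetP => A; rewrite inE => /andP[].
have disj : D :&: [set z + w | w in D] = finset.set0.
  apply/setP => w; rewrite finset.in_setI finset.in_set0; apply/negP => /andP[wD /imsetP[w' w'D def_w]].
  case/negP: zD; rewrite (_ : z = w - w'); last by rewrite def_w addrK.
  apply/agree_setP => A B AS BS; rewrite !mulmxBr.
  have /agree_setP/(_ A B AS BS) -> := wD.
  by have /agree_setP/(_ A B AS BS) -> := w'D.
rewrite mul2n -addnn -{2}(card_imset (mem D) (addrI z)) -cardsUI disj cards0 addn0.
apply: subset_leq_card; rewrite finset.subUset sub1 /=.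
apply/fintype.subsetP => _ /imsetP[w /agree_setP wD ->]; apply/agree_setP => A B.
rewrite !inE => /andP[AS /eqP Az] /andP[BS /eqP Bz].
by rewrite !mulmxDr Az Bz (wD A B).
Qed.

Definition identified l m (t : dtree (lin_domain l m)) (q : nat) :
    {set 'M['F_2]_(m, l)} :=
  [set A | (dtree_queries t (lin_concept A) <= q)%N &
           dtree_output t (lin_concept A) == lin_concept A].

(* A branch with answer 1 at a new [z] is charged a factor [1/x], and it halves
   the set of vectors whose image is still undetermined. *)
Lemma card_identified (R : realFieldType) (x : R) l m
    (t : dtree (lin_domain l m)) (q k : nat) (S : {set 'M['F_2]_(m, l)}) :
  0 < x <= 1 -> (2 ^ l <= #|agree_set S| * 2 ^ k)%N ->
  #|S :&: identified t q|%:R <= (1 + x) ^+ q * x ^- k.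
Proof.
move=> /andP[x0 x1].
have pos q' k' : 0 <= (1 + x) ^+ q' * x ^- k'.
  by rewrite mulr_ge0 ?invr_ge0 ?exprn_ge0 //; lra.
have xk k' : 1 <= x ^- k'.
  by rewrite invf_ge1 ?exprn_gt0// exprn_ile1// ltW.
elim: t q k S => [h|[z y] t0 IH0 t1 IH1] q k S hk.
  apply: (@le_trans _ _ 1).
    rewrite (_ : 1 = 1%:R) // ler_nat; apply/card_le1_eqP => A B.
    rewrite !inE /= => /andP[_ /eqP hA] /andP[_ /eqP hB].
    by apply: lin_concept_inj; rewrite -hA.
  apply: mulr_ege1 => //; apply: exprn_ege1; lra.
case: q => [|q].
  rewrite (_ : _ :&: _ = finset.set0) ?cards0 ?pos //.
  by apply/setP => A; rewrite !inE andbF.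
set S1 := [set A in S | A *m z == y]; set S0 := [set A in S | A *m z != y].
have split : S :&: identified (Ask (z, y) t0 t1) q.+1 \subset
    (S1 :&: identified t1 q) :|: (S0 :&: identified t0 q).
  apply/fintype.subsetP => A; rewrite !inE /= ffunE /= ltnS => /andP[-> /=].
  by case: (A *m z == y) => /= ->; rewrite ?orbT.
have le01 (c : nat) : (c <= #|S1 :&: identified t1 q| + #|S0 :&: identified t0 q|)%N ->
    c%:R <= #|S1 :&: identified t1 q|%:R + #|S0 :&: identified t0 q|%:R :> R.
  by rewrite -natrD ler_nat.
have := le01 _ (leq_trans (subset_leq_card split) (leq_card_setU _ _)).
move=> /le_trans; apply.
have sub1 : S1 \subset S by apply/fintype.subsetP => A; rewrite inE => /andP[].
have sub0 : S0 \subset S by apply/fintype.subsetP => A; rewrite inE => /andP[].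
have hk1 : (2 ^ l <= #|agree_set S1| * 2 ^ k)%N.
  by apply: leq_trans hk _; rewrite leq_mul2r subset_leq_card ?orbT// agree_setS.
have hk0 : (2 ^ l <= #|agree_set S0| * 2 ^ k)%N.
  by apply: leq_trans hk _; rewrite leq_mul2r subset_leq_card ?orbT// agree_setS.
(* For [z] in [agree_set S] the answer is the same for all of [S]: one branch is empty and nothing
   is charged. *)
have [zD | zD] := boolP (z \in agree_set S).
  have one0 : #|S1 :&: identified t1 q|%:R <= 0 :> R \/
              #|S0 :&: identified t0 q|%:R <= 0 :> R.
    have [->|[A AS1]] := set_0Vmem S1; first by left; rewrite finset.set0I cards0.
    right; rewrite (_ : _ :&: _ = finset.set0) ?cards0 //; apply/setP => B.
    rewrite !inE; apply/negP => /andP[/andP[BS /negP Bz] _]; apply: Bz.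
    move: AS1; rewrite inE => /andP[AS Az].
    by move/agree_setP: zD => /(_ B A BS AS) ->.
  have e : (1 + x) ^+ q.+1 * x ^- k =
      (1 + x) ^+ q * x ^- k + x * ((1 + x) ^+ q * x ^- k).
    by rewrite exprS; ring.
  have := IH1 q k S1 hk1; have := IH0 q k S0 hk0.
  have := mulr_ge0 (ltW x0) (pos q k).
  by rewrite e; case: one0; lra.
(* [k] bounds the codimension of [agree_set S], so at 0 no new [z] is left. Otherwise answer 1
   lowers [k] by one, and the bounds of the two branches add up to exactly the claimed one. *)
case: k hk hk0 hk1 => [|k] hk hk0 hk1.
  case/negP: zD; suff -> : agree_set S = finset.setT by rewrite inE.
  apply/eqP; rewrite eqEcard finset.subsetT cardsT card_mx card_Fp // muln1.
  by rewrite expn0 muln1 in hk.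
have hk1' : (2 ^ l <= #|agree_set S1| * 2 ^ k)%N.
  have := agree_set_double y zD; move: hk; rewrite -/S1 expnS => hk hd.
  by apply: leq_trans hk _; rewrite mulnA leq_mul2r mulnC hd orbT.
have := IH1 q k S1 hk1'; have := IH0 q k.+1 S0 hk0.
have -> : (1 + x) ^+ q.+1 * x ^- k.+1 =
    (1 + x) ^+ q * x ^- k + (1 + x) ^+ q * x ^- k.+1.
  by rewrite !exprS; field; rewrite ?expf_neq0 ?gt_eqF.
by lra.
Qed.

Lemma rand_learnable_lb (R : realType) (l m q : nat) :
  (1 <= l)%N -> (1 <= m)%N ->
  rand_learnable R (lin_class l m) q -> 10^-1 * 2 ^+ m * l%:R <= q%:R :> R.
Proof.
move=> l1 m1 [L hL]; rewrite leNgt; apply/negP => hq.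
set N := #|{: 'M['F_2]_(m, l)}|.
have defN : N%:R = (2 ^+ m) ^+ l :> R.
  by rewrite /N card_mx card_Fp // expnM !natrX.
have N0 : 0 < N%:R :> R by rewrite defN !exprn_gt0.
have m0 : 0 < 2 ^+ m :> R by rewrite exprn_gt0.
(* With this [x], [q * x < l / 5], so [(1 + x) ^+ q] is at most [expR (l / 5) <= (5/4) ^+ l], while
   [x ^- l] is [N / 2 ^+ l]. The product is at most [(5/8) ^+ l * N], and 5/8 < 2/3. *)
pose x : R := 2 / 2 ^+ m.
have x01 : 0 < x <= 1.
  rewrite divr_gt0 //= ler_pdivrMr // mul1r -[X in X <= _]expr1.
  by rewrite ler_weXn2l // ler1n.
have bound s : #|identified (rl_tree L s) q|%:R <= 5/8 * N%:R :> R.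
  have := @card_identified R x l m (rl_tree L s) q l [set: 'M['F_2]_(m, l)] x01.
  rewrite finset.setTI => h; apply: le_trans (h _) _.
    rewrite -[X in (X <= _)%N]mul1n leq_mul2r; apply/orP; right.
    by apply/card_gt0P; exists 0; apply/agree_setP => A B; rewrite !mulmx0.
  have e5 : expR (5^-1 : R) <= 5/4.
    have := expR_ge1Dx (- 5^-1 : R); rewrite expRN => h5.
    have p := expR_gt0 (5^-1 : R).
    rewrite -[X in X <= _]invrK -[X in _ <= X]invrK lef_pV2 ?posrE ?invr_gt0 //.
    apply: le_trans h5; lra.
  have : (1 + x) ^+ q <= (5/4) ^+ l.
    apply: (@le_trans _ _ (expR x ^+ q)).
      by apply: lerXn2r; rewrite ?nnegrE ?expR_ge0 ?expR_ge1Dx //; lra.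
    rewrite -expRM_natr; apply: (@le_trans _ _ (expR (5^-1 * l%:R))).
      rewrite ler_expR /x mulrAC ler_pdivrMr //; lra.
    by rewrite expRM_natr; apply: lerXn2r; rewrite ?nnegrE ?expR_ge0 //; lra.
  move=> hx; apply: (@le_trans _ _ ((5/4) ^+ l * x ^- l)).
    by rewrite ler_pM2r // invr_gt0 exprn_gt0 //; case/andP: x01.
  rewrite -exprVn -exprMn /x invf_div (_ : 5/4 * _ = 5/8 * 2 ^+ m :> R); last by field.
  rewrite exprMn -defN ler_pM2r // -[X in _ <= X]expr1.
  by apply: ler_wiXn2l => //; lra.
(* Double counting: the success summed over all targets is the average over seeds of the number of
   identified matrices. *)
have : 2/3 * N%:R <= \sum_(A : 'M['F_2]_(m, l)) rl_success L (lin_concept A).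
  have -> : 2/3 * N%:R = \sum_(A : 'M['F_2]_(m, l)) (2/3) :> R.
    by rewrite sumr_const mulr_natr.
  apply: ler_sum => A _.
  by have /hL[] : lin_concept A \in lin_class l m by apply: imset_f.
rewrite /rl_success; under [X in _ <= X -> _]eq_bigr do rewrite big_mkcond.
rewrite exchange_big /= => h.
suff : 2/3 * N%:R <= 5/8 * N%:R :> R by lra.
apply: le_trans h _; rewrite -[X in _ <= X]mulr1 -[X in _ <= _ * X](rl_prob_sum1 L) mulr_sumr.
apply: ler_sum => s _.
apply: le_trans (_ : #|identified (rl_tree L s) q|%:R * rl_prob L s <= _); last first.
  apply: ler_wpM2r; first exact: rl_prob_ge0. exact: bound.
rewrite -big_mkcond /= sumr_const -[X in X <= _]mulr_natl ler_wpM2r ?rl_prob_ge0 // ler_nat.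
apply: subset_leq_card; apply/fintype.subsetP => A; rewrite !inE => hA.
by apply/andP; split => //; have /hL[] : lin_concept A \in lin_class l m by apply: imset_f.
Qed.

(** * Quantum lower bound *)

Section NormSq.
Variable K : numClosedFieldType.
Implicit Types (X W : finType) (n : nat).

Definition normsq n (v : 'cV[K]_n) : K := \sum_i `|v i 0| ^+ 2.

Lemma normsq_enum (T : finType) (v : 'cV[K]_#|T|) :
  normsq v = \sum_s `|v (enum_rank s) 0| ^+ 2.
Proof. by rewrite /normsq (reindex enum_rank) //=; apply/onW_bij/enum_rank_bij. Qed.

Lemma normsqE n (v : 'cV[K]_n) : normsq v = (map_mx Num.conj v^T *m v) 0 0.
Proof. by rewrite mxE; apply: eq_bigr => i _; rewrite !mxE normCK mulrC. Qed.

Lemma normsq_unitary n (U : 'M[K]_n) (v : 'cV[K]_n) :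
  U \is unitarymx -> normsq (U *m v) = normsq v.
Proof.
move=> /unitarymxP /mulmx1C UU.
by rewrite !normsqE trmx_mul map_mxM mulmxA -[_ *m _ *m U]mulmxA UU mulmx1.
Qed.

Lemma normsq_ket (T : finType) (s : T) : normsq (ket K s) = 1.
Proof.
rewrite normsq_enum (bigD1 s) //= big1 ?addr0; first by rewrite mxE !eqxx normr1 expr1n.
by move=> s' ss'; rewrite mxE (inj_eq enum_rank_inj) (negPf ss') normr0 expr0n.
Qed.

(** The gap, after the triangle inequality, is a perfect square. The weight [c] is tuned to each
    use: 1, 6 and [q.+1%:R^-1]. *)
Lemma normCD_sqr_le (c a b : K) : 0 < c ->
  `|a + b| ^+ 2 <= (1 + c) * `|a| ^+ 2 + (1 + c^-1) * `|b| ^+ 2.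
Proof.
move=> c0; apply: (@le_trans _ _ ((`|a| + `|b|) ^+ 2)).
  by apply: lerXn2r; rewrite ?nnegrE ?addr_ge0 ?ler_normD.
rewrite -subr_ge0 (_ : _ - _ = c^-1 * (c * `|a| - `|b|) ^+ 2); last first.
  by field; rewrite gt_eqF.
by rewrite mulr_ge0 ?invr_ge0 ?(ltW c0) // real_exprn_even_ge0 // realB ?realM ?normr_real ?gtr0_real.
Qed.

Lemma normsqD_le n (c : K) (u v : 'cV[K]_n) : 0 < c ->
  normsq (u + v) <= (1 + c) * normsq u + (1 + c^-1) * normsq v.
Proof.
move=> c0; rewrite /normsq !mulr_sumr -big_split /=; apply: ler_sum => i _.
by rewrite mxE normCD_sqr_le.
Qed.

Lemma query_labelK X W (c : concept X) : involutive (@query_label X W c).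
Proof. by move=> [[x b] w] /=; rewrite addbK. Qed.

Lemma query_mxE X W (c : concept X) (v : 'cV[K]_#|qbasis X W|) i :
  (query_mx K W c *m v) i 0 = v (enum_rank (query_label c (enum_val i))) 0.
Proof.
rewrite mxE (bigD1 (enum_rank (query_label c (enum_val i)))) //= big1 ?addr0.
  by rewrite mxE enum_rankK query_labelK eqxx mul1r.
move=> j ji; rewrite mxE; case: eqP => [e|]; last by rewrite mul0r.
by case/eqP: ji; rewrite e query_labelK enum_valK.
Qed.

Lemma normsq_query X W (c : concept X) (v : 'cV[K]_#|qbasis X W|) :
  normsq (query_mx K W c *m v) = normsq v.
Proof.
rewrite !normsq_enum [RHS](reindex (@query_label X W c)) /=; last first.
  by apply/onW_bij/inv_bij/query_labelK.
by apply: eq_bigr => s _; rewrite query_mxE enum_rankK.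
Qed.

(** The two images differ only at positions where [c] and [h] differ. There the squared difference
    is at most twice each squared term, and each query merely permutes the labels over a position,
    whence 2 + 2. *)
Lemma normsq_query_sub X W (c h : concept X) (v : 'cV[K]_#|qbasis X W|) :
  normsq (query_mx K W c *m v - query_mx K W h *m v) <=
  4 * \sum_(s : qbasis X W | c s.1.1 != h s.1.1) `|v (enum_rank s) 0| ^+ 2.
Proof.
rewrite normsq_enum (bigID (fun s : qbasis X W => c s.1.1 != h s.1.1)) /=.
rewrite [X in _ + X]big1 ?addr0; last first.
  move=> [[x b] w] /=; rewrite negbK => /eqP e.
  by rewrite mxE [in X in _ + X]mxE !query_mxE !enum_rankK /= e subrr normr0 expr0n.
pose f (d : concept X) (s : qbasis X W) := `|v (enum_rank (query_label d s)) 0| ^+ 2.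
apply: (@le_trans _ _ (\sum_(s : qbasis X W | c s.1.1 != h s.1.1) (2 * f c s + 2 * f h s))).
  apply: ler_sum => s _; rewrite mxE [in X in _ + X]mxE !query_mxE !enum_rankK.
  have := @normCD_sqr_le 1 (v (enum_rank (query_label c s)) 0)
    (- v (enum_rank (query_label h s)) 0) ltr01.
  by rewrite normrN invr1 /f.
have fE (d : concept X) : \sum_(s : qbasis X W | c s.1.1 != h s.1.1) f d s =
    \sum_(s : qbasis X W | c s.1.1 != h s.1.1) `|v (enum_rank s) 0| ^+ 2.
  rewrite [RHS](reindex (@query_label X W d)) /=; last first.
    by apply/onW_bij/inv_bij/query_labelK.
  by apply: eq_bigl => [[[x b] w]].
by rewrite big_split /= -!mulr_sumr !fE -mulrDl -natrD.
Qed.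

Lemma normsq_state X (L : qlearner K X) (c : concept X) q :
  normsq (ql_state L c q) = 1.
Proof.
elim: q => [|q IH] /=; rewrite normsq_unitary ?ql_unitaryP //.
  exact: normsq_ket.
by rewrite normsq_query.
Qed.

(** Hybrid argument: each query adds a discrepancy measured on the run for [h], and unitaries
    preserve what has accumulated. The factor [q] is the Cauchy-Schwarz loss for a sum of [q]
    vectors. *)
Lemma normsq_state_sub X (L : qlearner K X) (c h : concept X) q :
  normsq (ql_state L c q - ql_state L h q) <=
  q%:R * \sum_(t < q) normsq (query_mx K (ql_work L) c *m ql_state L h t
                              - query_mx K (ql_work L) h *m ql_state L h t).
Proof.
elim: q => [|q IH] /=.
  rewrite subrr mul0r /normsq big1 // => i _.
  by rewrite mxE normr0 expr0n.
rewrite -mulmxBr normsq_unitary ?ql_unitaryP // big_ord_recr /=.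
set E := normsq (query_mx K (ql_work L) c *m ql_state L h q - _).
rewrite (_ : _ - _ = query_mx K (ql_work L) c *m (ql_state L c q - ql_state L h q) +
  (query_mx K (ql_work L) c *m ql_state L h q - query_mx K (ql_work L) h *m ql_state L h q)); last first.
  by rewrite mulmxBr addrA subrK.
case: q IH @E => [|q] IH E.
  rewrite big_ord0 add0r mul1r /= subrr mulmx0 add0r //.
have q0 : 0 < q.+1%:R :> K by rewrite ltr0n.
(* This weight gives the accumulated sum and the new term the same factor [q.+2]. It is the inverse
   of the number of earlier queries, so the first query was treated apart. *)
apply: le_trans (normsqD_le _ _ (_ : 0 < q.+1%:R^-1)) _; first by rewrite invr_gt0.
rewrite invrK normsq_query -/E [q.+2%:R]mulrS [X in _ <= X]mulrDr lerD2r.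
have -> : 1 + q.+1%:R = (1 + q.+1%:R^-1) * q.+1%:R :> K.
  by rewrite mulrDl mulVf ?gt_eqF // mul1r addrC.
by rewrite -mulrA ler_wpM2l // addr_ge0 ?invr_ge0 ?ler01 // ltW.
Qed.

(* Each position of [X] distinguishes the reference concept [h] from at most one
   [c i], so a learner can spend query weight on few of the [c i] only. *)
Lemma hybrid_bound X (I : finType) (L : qlearner K X) (c : I -> concept X)
    (h : concept X) (q : nat) :
  injective c ->
  (forall x i j, c i x != h x -> c j x != h x -> i = j) ->
  (1 < #|I|)%N -> (forall i, 2 / 3 <= ql_success L (c i) q) ->
  (#|I| <= 336 * q ^ 2)%N.
Proof.
move=> c_inj disj I2 succ.
(* Events disjoint over [i] have total weight at most the squared norm; this serves both for query
   positions and for outputs. *)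
have sumle (P : I -> qbasis X (ql_work L) -> bool) (v : 'cV[K]_#|qbasis X (ql_work L)|) :
    (forall s i j, P i s -> P j s -> i = j) ->
    \sum_i \sum_(s | P i s) `|v (enum_rank s) 0| ^+ 2 <= normsq v.
  move=> Pdisj; under eq_bigr do rewrite big_mkcond.
  rewrite exchange_big normsq_enum; apply: ler_sum => s _ /=.
  rewrite -big_mkcond /=; have [i Pi|P0] := pickP (P^~ s).
    rewrite (bigD1 i) //= big1 ?addr0 // => j /andP[Pj /eqP[]].
    exact: Pdisj Pj Pi.
  by rewrite big_pred0 // exprn_ge0.
set D := fun i => normsq (ql_state L (c i) q - ql_state L h q).
have DS : \sum_i D i <= 4 * q%:R ^+ 2.
  apply: (@le_trans _ _ (\sum_i (q%:R * \sum_(t < q) (4 *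
      \sum_(s : qbasis X (ql_work L) | c i s.1.1 != h s.1.1) `|ql_state L h t (enum_rank s) 0| ^+ 2)))).
    apply: ler_sum => i _; apply: le_trans (normsq_state_sub _ _ _ _) _.
    by rewrite ler_wpM2l //; apply: ler_sum => t _; apply: normsq_query_sub.
  rewrite -mulr_sumr exchange_big /= expr2 mulrA [4 * _]mulrC -mulrA ler_wpM2l //.
  rewrite [4 * _]mulrC mulr_natl -[X in _ <= _ *+ X]card_ord -sumr_const.
  apply: ler_sum => t _; rewrite -mulr_sumr -[X in _ <= X]mulr1 ler_wpM2l //.
  by rewrite -(normsq_state L h t); apply: sumle => s i j; apply: disj.
have e7 : 1 + 6 = 7 :> K by ring.
have e76 : 1 + 6^-1 = 7 / 6 :> K by field.
(* Success on [c i] is charged to the distance from the reference run and to the chance that the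
   reference run itself outputs [c i]. Weight 6 makes the latter sum to at most 7/6. *)
have one i : 2 / 3 <= 7 * D i +
    7 / 6 * \sum_(s | ql_out L s == c i) `|ql_state L h q (enum_rank s) 0| ^+ 2.
  apply: le_trans (succ i) _; rewrite /D normsq_enum mulr_sumr.
  rewrite [X in _ <= X + _](bigID (fun s => ql_out L s == c i)) /=.
  set Y := \sum_(s | ~~ _) _; have Y0 : 0 <= Y.
    by apply: sumr_ge0 => s _; rewrite mulr_ge0 ?exprn_ge0.
  rewrite addrAC -[X in X <= _]addr0; apply: lerD => //.
  rewrite mulr_sumr -big_split /=; apply: ler_sum => s _.
  have c0 : 0 < 6 :> K by rewrite ltr0n.
  have := @normCD_sqr_le 6
    ((ql_state L (c i) q - ql_state L h q) (enum_rank s) 0) (ql_state L h q (enum_rank s) 0) c0.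
  rewrite e7 e76.
  by rewrite !mxE subrK.
have tot : 2 / 3 * #|I|%:R <= 28 * q%:R ^+ 2 + 7 / 6 :> K.
  have -> : 2 / 3 * #|I|%:R = \sum_(i : I) (2 / 3) :> K by rewrite sumr_const mulr_natr.
  apply: (@le_trans _ _ (\sum_i (7 * D i + 7 / 6 * \sum_(s | ql_out L s == c i)
      `|ql_state L h q (enum_rank s) 0| ^+ 2))); first by apply: ler_sum.
  rewrite big_split /= -!mulr_sumr; apply: lerD.
    by rewrite (_ : 28 = 7 * 4); [rewrite -mulrA ler_wpM2l | ring].
  rewrite -[X in _ <= X]mulr1 ler_wpM2l ?divr_ge0 //.
  by rewrite -(normsq_state L h q); apply: sumle => s i j /eqP -> /eqP /c_inj.
(* The additive 14 is absorbed by [7 * #|I|], since [I] has at least two elements. *)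
have : (8 * #|I| <= 336 * q ^ 2 + 14)%N.
  rewrite -(ler_nat K) natrD !natrM -expr2.
  have c0 : 0 < 12 :> K by rewrite ltr0n.
  have -> : 8 * #|I|%:R = 12 * (2 / 3 * #|I|%:R) :> K by field.
  have -> : 336 * q%:R ^+ 2 + 14 = 12 * (28 * q%:R ^+ 2 + 7 / 6) :> K by field.
  by rewrite ler_pM2l.
by lia.
Qed.
End NormSq.

Lemma quantum_learnable_lb (R : realType) (l m q : nat) :
  (1 <= l)%N -> (1 <= m)%N ->
  quantum_learnable R (lin_class l m) q -> (2 ^ m <= 336 * q ^ 2)%N.
Proof.
case: l => // l _ m1 [L hL].
pose c (v : 'cV['F_2]_m) := lin_concept (v *m delta_mx 0 0 : 'M['F_2]_(m, l.+1)).
(* The search without a marked item: it differs from [c v] only where [z 0 0 = 1] and [y = v]. It is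
   not the graph of a map, but the hybrid argument allows any reference concept. *)
pose h : concept (lin_domain l.+1 m) := [ffun zy => ((zy.1 : 'cV['F_2]_l.+1) 0 0 == 0) && (zy.2 == 0)].
have cE v z y : c v (z, y) = (z 0 0 *: v == y).
  rewrite ffunE /= -mulmxA; congr (_ == _).
  rewrite -rowE (_ : row 0 z = (z 0 0)%:M) ?mul_mx_scalar //.
  by apply/rowP => i; rewrite !mxE !ord1 mulr1n.
have F2 (a : 'F_2) : a != 0 -> a = 1 by case: a => [[|[|]]] //= i _; apply/val_inj.
have -> : (2 ^ m)%N = #|{: 'cV['F_2]_m}| by rewrite card_mx card_Fp // muln1.
apply: (@hybrid_bound R[i] _ _ L c h q).
- move=> v w /ffunP/(_ (delta_mx 0 0, w)); rewrite !cE !mxE !eqxx !scale1r.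
  by rewrite eqxx => /eqP.
- move=> [z y] v w; rewrite !cE !ffunE /=.
  have [->|/F2 ->] := eqVneq (z 0 0) 0; first by rewrite !scale0r /= [0 == y]eq_sym eqxx.
  by rewrite !scale1r /= !eqbF_neg !negbK => /eqP-> /eqP->.
- by rewrite card_mx card_Fp // muln1 (leq_exp2l 1).
- by move=> v; apply: hL; apply: imset_f.
Qed.

(** * Query algorithms from Gram matrices *)

Section Orthogonal.
Variable F : realFieldType.

Definition dot n (u v : 'cV[F]_n) : F := (u^T *m v) 0 0.

Lemma dotC n (u v : 'cV[F]_n) : dot u v = dot v u.
Proof. by rewrite /dot !mxE; apply: eq_bigr => i _; rewrite !mxE mulrC. Qed.

Lemma dotBr n (u v w : 'cV[F]_n) : dot u (v - w) = dot u v - dot u w.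
Proof. by rewrite /dot mulmxBr !mxE. Qed.

Lemma dot_eq0 n (u : 'cV[F]_n) : dot u u = 0 -> u = 0.
Proof.
rewrite /dot mxE => h; have nn (i : 'I_n) : true -> 0 <= u^T 0 i * u i 0.
  by rewrite mxE -expr2 sqr_ge0.
apply/colP => i; have : u^T 0 i * u i 0 = 0 by apply: (psumr_eq0P nn h).
by rewrite !mxE => /eqP; rewrite mulf_eq0 orbb => /eqP.
Qed.

Lemma dot_orthogonal n (U : 'M[F]_n) (u v : 'cV[F]_n) :
  U *m U^T = 1%:M -> dot (U *m u) (U *m v) = dot u v.
Proof.
by move=> /mulmx1C UU; rewrite /dot trmx_mul mulmxA -[_ *m _ *m U]mulmxA UU mulmx1.
Qed.

(** Reflection in the hyperplane orthogonal to [u - v]. If [u = v], division by zero gives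
    coefficient 0 and the reflection becomes the identity. *)
Lemma householder n (u v : 'cV[F]_n) : dot u u = dot v v ->
  exists H : 'M[F]_n, [/\ H *m H^T = 1%:M, H *m u = v &
    forall w, dot w u = dot w v -> H *m w = w].
Proof.
move=> uv; pose w := u - v; pose c := 2 / dot w w.
have scal (x : 'cV[F]_n) : w *m (w^T *m x) = dot w x *: w.
  by rewrite [w^T *m x]mx11_scalar mul_mx_scalar.
have HE x : (1%:M - c *: (w *m w^T)) *m x = x - (c * dot w x) *: w.
  by rewrite mulmxBl mul1mx -scalemxAl -mulmxA scal scalerA.
have HT : (1%:M - c *: (w *m w^T))^T = 1%:M - c *: (w *m w^T).
  by rewrite raddfB /= [(c *: _)^T]linearZ /= trmx1 trmx_mul trmxK.
have Hw : w - (c * dot w w) *: w = - w.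
  have [/dot_eq0 ->|w0] := eqVneq (dot w w) 0; first by rewrite scaler0 subrr oppr0.
  by rewrite /c divfK // scaler_nat mulr2n opprD addrA subrr sub0r.
exists (1%:M - c *: (w *m w^T)); split=> [||x xuv].
- by rewrite HT mulmxBr mulmx1 -scalemxAr mulmxA HE Hw mulNmx scalerN opprK subrK.
- rewrite HE; have [w0|w0] := eqVneq (dot w w) 0.
    by have := dot_eq0 w0; rewrite /w => /eqP; rewrite subr_eq0 => /eqP ->; rewrite subrr scaler0 subr0.
  have e : dot w w = 2 * dot w u.
    rewrite {2}/w dotBr [dot w v]dotC [dot w u]dotC /w !dotBr -uv [dot v u]dotC; ring.
  have -> : c * dot w u = 1.
    by rewrite /c e; field; move: w0; rewrite e mulf_eq0 negb_or => /andP[].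
  by rewrite scale1r /w opprB addrC subrK.
- by rewrite HE dotC dotBr xuv subrr mulr0 scale0r subr0.
Qed.

(** Induction on the list: a reflection sends the current image of [f k] to [g k]. It fixes the
    vectors [g i] already attained, because equal Gram matrices give them equal products with
    both. *)
Lemma orthogonal_of_gram n (I : eqType) (f g : I -> 'cV[F]_n) (s : seq I) :
  (forall i j, dot (f i) (f j) = dot (g i) (g j)) ->
  exists2 U : 'M[F]_n, U *m U^T = 1%:M & {in s, forall i, U *m f i = g i}.
Proof.
move=> fg; elim: s => [|k s [U UU Ufg]]; first by exists 1%:M; rewrite ?trmx1 ?mulmx1.
have [|H [HH Hk Hfix]] := @householder n (U *m f k) (g k).
  by rewrite dot_orthogonal.
exists (H *m U) => [|i]; first by rewrite trmx_mul mulmxA -[H *m U *m _]mulmxA UU mulmx1.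
rewrite inE -mulmxA => /predU1P[-> //|si].
by rewrite Ufg // Hfix // -(Ufg i si) dot_orthogonal // Ufg.
Qed.
End Orthogonal.

(** * State conversion and its realization by unitaries *)

Section Conversion.
Variables (R : realType) (X W I : finType) (c : I -> concept X).
Local Notation T := (qbasis X W).
Implicit Types (G : I -> I -> R) (f : I -> T -> R).

Definition gram f i j : R := \sum_s f i s * f j s.

(** Precomposition gives the action on amplitudes because [query_label] is its own inverse. *)
Definition query_fun f i : T -> R := f i \o query_label (c i).

(* The state conversion problem for Gram matrices: whether a query algorithm
   can turn one family of states into another depends on their Gram matrices
   only. *)
Fixpoint convertible (q : nat) G G' : Prop :=
  if q is q'.+1 then
    exists f, convertible q' G (gram f) /\ G' = gram (query_fun f)
  else G = G'.

Lemma convertible_trans q q' G1 G2 G3 :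
  convertible q G1 G2 -> convertible q' G2 G3 -> convertible (q + q') G1 G3.
Proof.
move=> h12; elim: q' G3 => [|q' IH] G3 /= => [<-|[f [/IH h ->]]]; rewrite ?addn0 //.
by rewrite addnS /=; exists f.
Qed.

Lemma query_funK f : query_fun (query_fun f) = f.
Proof.
apply/funext => i; apply/funext => s.
by rewrite /query_fun /= query_labelK.
Qed.

Lemma convertible1 f : convertible 1 (gram f) (gram (query_fun f)).
Proof. by exists f. Qed.

(** A query is an involution, so an algorithm can be run backwards; this provides uncomputation. *)
Lemma convertible_sym q G G' : convertible q G G' -> convertible q G' G.
Proof.
elim: q G' => [|q IH] G' /= => [//|[f [/IH h ->]]].
have := convertible1 (query_fun f); rewrite query_funK => h1.
exact: (convertible_trans h1 h).
Qed.

Definition state_vec (f : T -> R) : 'cV[R]_#|T| := \col_i f (enum_val i).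

Lemma dot_state_vec f i j : dot (state_vec (f i)) (state_vec (f j)) = gram f i j.
Proof.
rewrite /dot /gram mxE (reindex enum_rank) /=; last exact/onW_bij/enum_rank_bij.
by apply: eq_bigr => k _; rewrite !mxE enum_rankK.
Qed.

Local Notation toC := (map_mx (real_complex R)).

Lemma query_mx_state_vec f i :
  query_mx R[i] W (c i) *m toC (state_vec (f i)) = toC (state_vec (query_fun f i)).
Proof.
by apply/colP => k; rewrite query_mxE !mxE enum_rankK.
Qed.

Fixpoint run (V : nat -> 'M[R[i]]_#|T|) (h : concept X) (v : 'cV[R[i]]_#|T|) q :=
  if q is q'.+1 then V q *m (query_mx R[i] W h *m run V h v q') else V 0 *m v.

Lemma eq_run V V' h v q : (forall k, (k <= q)%N -> V k = V' k) -> run V h v q = run V' h v q.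
Proof.
elim: q => [|q IH] VV' /=; first by rewrite VV'.
by rewrite VV' // IH // => k kq; apply: VV'; apply: leqW.
Qed.

(** Between queries [convertible] only equates Gram matrices; [orthogonal_of_gram] supplies an
    orthogonal matrix realizing each such equality for all targets at once. *)
Lemma run_of_convertible q a b : convertible q (gram a) (gram b) ->
  exists2 V : nat -> 'M[R]_#|T|, (forall k, V k *m (V k)^T = 1%:M) &
  forall i, run (fun k => toC (V k)) (c i) (toC (state_vec (a i))) q = toC (state_vec (b i)).
Proof.
have ext f g : gram f = gram g -> exists2 U : 'M[R]_#|T|, U *m U^T = 1%:M &
    forall i, U *m state_vec (f i) = state_vec (g i).
  move=> fg; have [|U UU Ufg] := @orthogonal_of_gram R _ _ (state_vec \o f) (state_vec \o g) (enum I).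
    by move=> i j; rewrite /= !dot_state_vec fg.
  by exists U => // i; apply: Ufg; rewrite mem_enum.
elim: q b => [|q IH] b /= => [/ext[U UU Uab]|[f [/IH [V VV Vaf] /esym/ext[U UU Ufb]]]].
  by exists (fun=> U) => // i; rewrite -map_mxM Uab.
exists (fun k => if k == q.+1 then U else V k) => [k|i]; first by case: ifP.
rewrite eqxx (@eq_run _ (fun k => toC (V k))); last by move=> k kq; rewrite ltn_eqF.
by rewrite Vaf query_mx_state_vec -map_mxM Ufb.
Qed.

(** The all-ones Gram matrix is that of an initial state common to all targets. The identity is that
    of distinct basis states, which a measurement tells apart with certainty. *)
Lemma learner_of_convertible q (init : T) (lab : I -> T) :
  injective c -> injective lab ->
  convertible q (fun _ _ => 1) (fun i j => (i == j)%:R) ->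
  exists L : qlearner R[i] X, forall i, ql_success L (c i) q >= 1.
Proof.
move=> c_inj lab_inj conv.
pose a (i : I) s : R := (s == init)%:R; pose b i s : R := (s == lab i)%:R.
have aE : gram a = fun _ _ => 1.
  apply/funext => i; apply/funext => j; rewrite /gram (bigD1 init) //= big1 ?addr0.
    by rewrite /a eqxx mulr1.
  by move=> s /negPf e; rewrite /a e mul0r.
have bE : gram b = fun i j => (i == j)%:R.
  apply/funext => i; apply/funext => j; rewrite /gram (bigD1 (lab i)) //= big1 ?addr0.
    by rewrite /b eqxx mul1r (inj_eq lab_inj).
  by move=> s /negPf e; rewrite /b e mul0r.
have [|V VV Vab] := @run_of_convertible q a b; first by rewrite aE bE.
have VU k : toC (V k) \is unitarymx.
  apply/unitarymxP; rewrite map_trmx -[RHS](map_mx1 (real_complex R)) -(VV k) map_mxM.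
  congr (_ *m _); apply/matrixP => i j; rewrite !mxE.
  by apply/conj_Creal/complex_realP; exists (V k j i).
pose out (s : T) := if [pick i | lab i == s] is Some i then c i else [ffun=> false].
exists (@QLearner R[i] X W init (fun k => toC (V k)) out VU) => i.
rewrite /ql_success (bigD1 (lab i)) /=; last first.
  rewrite /out; case: pickP => [j /eqP/lab_inj -> //|/(_ i)].
  by rewrite eqxx.
set v := ql_state _ _ _.
have -> : v = toC (state_vec (b i)).
  rewrite -Vab /v.
  have -> : toC (state_vec (a i)) = ket R[i] init.
    apply/colP => k; rewrite !mxE eqxx andbT /a -(inj_eq enum_rank_inj) enum_valK.
    by case: eqP.
  by elim: q {v conv Vab} => [|q /= <-].
rewrite !mxE enum_rankK /b eqxx normr1 expr1n lerDl.
by apply: sumr_ge0 => s _; rewrite exprn_ge0.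
Qed.
End Conversion.

(** * Learning the rows *)

Section LinearLearner.
Variables (R : realType) (l m : nat).
Local Notation mat := 'M['F_2]_(m, l).
Local Notation X := (lin_domain l m).
Local Notation W := (mat * bool)%type.
Local Notation c := (@lin_concept l m).

Definition top_rows (j : nat) (A : mat) : mat :=
  \matrix_(i, k) if (i < j)%N then A i k else 0.

Definition top_eq (j : nat) (y s : 'cV['F_2]_m) : bool :=
  [forall i : 'I_m, (i < j)%N ==> (y i 0 == s i 0)].

Lemma top_eqP j (y s : 'cV['F_2]_m) :
  reflect (forall i : 'I_m, (i < j)%N -> y i 0 = s i 0) (top_eq j y s).
Proof.
by apply: (iffP forallP) => h i; [move/implyP: (h i) => hi /hi/eqP | apply/implyP => /h ->].
Qed.

Lemma top_eq_refl j y : top_eq j y y.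
Proof. by apply/top_eqP. Qed.

Lemma top_eq_mul j (A B : mat) (z : 'cV['F_2]_l) y :
  top_rows j A = top_rows j B -> top_eq j y (A *m z) = top_eq j y (B *m z).
Proof.
move=> AB; have e (i : 'I_m) : (i < j)%N -> (A *m z) i 0 = (B *m z) i 0.
  move=> ij; rewrite !mxE; apply: eq_bigr => k _.
  by have /matrixP/(_ i k) := AB; rewrite !mxE ij => ->.
by apply/top_eqP/top_eqP => h i ij; rewrite h // e.
Qed.

Definition top_card (j : nat) : nat := #|[set y | top_eq j y 0]|.

(** Fixing one more coordinate to 0 at least halves the set, since the smaller set and its translate
    by a unit vector are disjoint inside the larger one. *)
Lemma top_card_le j : (j <= m)%N -> (top_card j <= 2 ^ (m - j))%N.
Proof.
suff h : (j <= m)%N -> (2 ^ j * top_card j <= 2 ^ m)%N.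
  move=> jm; rewrite -(@leq_pmul2l (2 ^ j)) ?expn_gt0 // -expnD subnKC //.
  exact: h.
elim: j => [_|j IH jm].
  rewrite expn0 mul1n; apply: leq_trans (max_card _) _.
  by rewrite card_mx card_Fp // muln1.
apply: leq_trans (IH (ltnW jm)).
rewrite expnSr -mulnA leq_mul2l; apply/orP; right.
pose e : 'cV['F_2]_m := delta_mx (Ordinal jm) 0.
set S := [set y | top_eq j.+1 y 0].
have eS (y : 'cV['F_2]_m) : y \in S -> y (Ordinal jm) 0 = 0.
  by rewrite inE => /top_eqP/(_ (Ordinal jm) (ltnSn j)); rewrite mxE.
have disj : S :&: [set e + w | w in S] = finset.set0.
  apply/setP => w; rewrite finset.in_setI finset.in_set0; apply/negP.
  move=> /andP[/eS w0 /imsetP[w' /eS w'0 def_w]].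
  by move: w0; rewrite def_w !mxE !eqxx w'0 addr0 => /eqP; rewrite oner_eq0.
rewrite mul2n -addnn /top_card -/S -{2}(card_imset (mem S) (addrI e)) -cardsUI disj cards0 addn0.
apply: subset_leq_card; rewrite finset.subUset; apply/andP; split; apply/fintype.subsetP.
  by move=> y; rewrite !inE => /top_eqP h; apply/top_eqP => i ij; apply: h; apply: ltnW.
move=> _ /imsetP[y + ->]; rewrite !inE => /top_eqP h; apply/top_eqP => i ij.
rewrite !mxE (h i (ltnW ij)) !mxE addr0 eqxx andbT.
by case: eqP ij => // -> /=; rewrite ltnn.
Qed.

(* [beta + delta [y = s]] on the component of the output qubit along |->,
   [gamma [y = s]] on its component along |+>, where queries act trivially, and
   a component [eps], marked by the flag [w.2], that tops the norm up to 1. *)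
Definition branch (j : nat) (beta delta gamma eps : R) (s y : 'cV['F_2]_m)
    (b f : bool) : R :=
  if f then (y == 0)%:R * eps
  else (-1) ^+ b * ((top_eq j y s)%:R * (beta + delta * (y == s)%:R))
       + gamma * (y == s)%:R.

(** The square root normalizes the sum over the [2 ^ l] vectors [z] and the unnormalized states of
    the output qubit, each of squared norm 2. *)
Definition amplitude (j : nat) (chi : mat -> 'cV['F_2]_l -> R)
    (beta delta gamma eps : R) (A : mat) (x : qbasis X W) : R :=
  let: ((z, y), b, (P, f)) := x in
  (P == top_rows j A)%:R * (Num.sqrt (2 * 2 ^+ l)^-1 *
    (chi A z * branch j beta delta gamma eps (A *m z) y b f)).

(* Gram matrix when the top [j] rows are stored and [A *m z] is computed to the
   extent [d], from [0] (not at all) to [1] (exactly), in uniform superposition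
   over [z] with signs [chi]. *)
Definition stage_gram (j : nat) (chi : mat -> 'cV['F_2]_l -> R) (d : R) (A B : mat) : R :=
  (top_rows j A == top_rows j B)%:R *
  ((2 ^+ l)^-1 * \sum_z chi A z * chi B z * (1 - d * (A *m z != B *m z)%:R)).

Lemma sum_pick (T : finType) (f : T -> R) (a : T) : \sum_y f y * (y == a)%:R = f a.
Proof.
rewrite (bigD1 a) //= eqxx mulr1 big1 ?addr0 // => y /negPf ->.
by rewrite mulr0.
Qed.

(** The [beta] parts have the same support by hypothesis and the |-> and |+> parts are orthogonal,
    so only [delta ^+ 2 + gamma ^+ 2] distinguishes [s = s'] from [s != s']. *)
Lemma sum_branch j beta delta gamma eps (s s' : 'cV['F_2]_m) :
  (forall y, top_eq j y s = top_eq j y s') ->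
  \sum_y \sum_b \sum_f branch j beta delta gamma eps s y b f *
                       branch j beta delta gamma eps s' y b f =
  2 * ((top_card j)%:R * beta ^+ 2 + 2 * beta * delta + eps ^+ 2
       + (delta ^+ 2 + gamma ^+ 2) * (s == s')%:R).
Proof.
move=> ss'.
have cardE : (top_card j)%:R = \sum_y (top_eq j y s)%:R :> R.
  rewrite /top_card -sum1_card natr_sum big_mkcond /=.
  rewrite [RHS](reindex (fun y => y + s)) /=; last first.
    by apply/onW_bij; exists (fun y => y - s) => y; rewrite ?addrK ?subrK.
  apply: eq_bigr => y _; rewrite inE (_ : top_eq j (y + s) s = top_eq j y 0); first by case: ifP.
  apply/top_eqP/top_eqP => h i ij; have := h i ij; rewrite !mxE.
    by rewrite -[X in _ = X -> _]add0r => /addIr.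
  by move=> ->; rewrite add0r.
have term y : \sum_b \sum_f branch j beta delta gamma eps s y b f *
                            branch j beta delta gamma eps s' y b f =
    2 * (beta ^+ 2 * (top_eq j y s)%:R + beta * delta * (y == s)%:R
         + beta * delta * (y == s')%:R + eps ^+ 2 * (y == 0)%:R
         + (delta ^+ 2 + gamma ^+ 2) * (y == s')%:R * (y == s)%:R).
  have ts : top_eq j y s && (y == s) = (y == s).
    by case: eqP => [->|]; rewrite ?top_eq_refl ?andbF.
  have ts' : top_eq j y s && (y == s') = (y == s').
    by rewrite ss'; case: eqP => [->|]; rewrite ?top_eq_refl ?andbF.
  rewrite !big_bool /branch /= -ss' expr1 expr0.
  case: (top_eq j y s) ts ts'; case: (y == s); case: (y == s'); case: (y == 0) => //= _ _; ring.
under eq_bigr do rewrite term.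
by rewrite -mulr_sumr !big_split /= !sum_pick -mulr_sumr -cardE; ring.
Qed.

Lemma sum_qbasis (F : qbasis X W -> R) :
  \sum_x F x = \sum_z \sum_y \sum_b \sum_P \sum_f F ((z, y), b, (P, f)).
Proof.
rewrite (eq_bigr (fun x => F ((x.1.1.1, x.1.1.2), x.1.2, (x.2.1, x.2.2)))); last first.
  by move=> [[[z y] b] [P f]].
rewrite -(pair_bigA _ (fun u w => F ((u.1.1, u.1.2), u.2, (w.1, w.2)))) /=.
rewrite -(pair_bigA _ (fun u b => \sum_w F ((u.1, u.2), b, (w.1, w.2)))) /=.
rewrite -(pair_bigA _ (fun z y => \sum_b \sum_w F ((z, y), b, (w.1, w.2)))) /=.
apply: eq_bigr => z _; apply: eq_bigr => y _; apply: eq_bigr => b _.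
by rewrite -(pair_bigA _ (fun P f => F ((z, y), b, (P, f)))).
Qed.

(** For normalized states only [delta ^+ 2 + gamma ^+ 2] matters, so between queries the
    coefficients can be redistributed freely at a fixed value of this sum. *)
Lemma gram_amplitude j chi beta delta gamma eps :
  (top_card j)%:R * beta ^+ 2 + 2 * beta * delta + delta ^+ 2 + gamma ^+ 2 + eps ^+ 2 = 1 ->
  gram (amplitude j chi beta delta gamma eps) = stage_gram j chi (delta ^+ 2 + gamma ^+ 2).
Proof.
move=> norm; apply/funext => A; apply/funext => B; rewrite /gram sum_qbasis /stage_gram /amplitude.
set k := Num.sqrt _; have k2 : k ^+ 2 * 2 = (2 ^+ l)^-1.
  rewrite sqr_sqrtr; last by rewrite invr_ge0 mulr_ge0 ?exprn_ge0.
  by rewrite invfM mulrC mulrA divff ?mul1r // pnatr_eq0.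
pose br := branch j beta delta gamma eps.
have sumP z y b :
    \sum_P \sum_f
      (P == top_rows j A)%:R * (k * (chi A z * br (A *m z) y b f)) *
      ((P == top_rows j B)%:R * (k * (chi B z * br (B *m z) y b f))) =
    (top_rows j A == top_rows j B)%:R * (k ^+ 2 * (chi A z * chi B z)) *
      \sum_f br (A *m z) y b f * br (B *m z) y b f.
  rewrite -(sum_pick (fun P => (P == top_rows j B)%:R * (k ^+ 2 * (chi A z * chi B z)) *
      \sum_f br (A *m z) y b f * br (B *m z) y b f) (top_rows j A)).
  apply: eq_bigr => P _; rewrite mulr_sumr mulr_suml; apply: eq_bigr => f _; ring.
rewrite mulrA mulr_sumr; apply: eq_bigr => z _.
under eq_bigr => y _ do under eq_bigr => b _ do rewrite sumP.
under eq_bigr => y _ do rewrite -mulr_sumr.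
rewrite -mulr_sumr; have [AB|] := eqVneq (top_rows j A) (top_rows j B); last by rewrite !mul0r.
rewrite sum_branch; last by move=> y; apply: top_eq_mul.
have -> : (top_card j)%:R * beta ^+ 2 + 2 * beta * delta + eps ^+ 2
    + (delta ^+ 2 + gamma ^+ 2) * (A *m z == B *m z)%:R =
    1 - (delta ^+ 2 + gamma ^+ 2) * (A *m z != B *m z)%:R.
  by move: norm; case: eqP => _ /=; lra.
by rewrite -k2; ring.
Qed.

(** Phase kickback: at [y = s] the |-> coefficient [beta + delta] changes sign, which is the new
    [delta] relative to an unchanged [beta]. The [gamma] and [eps] parts do not depend on the output
    bit in sign and stay put. *)
Lemma query_amplitude j chi beta delta gamma eps :
  query_fun c (amplitude j chi beta delta gamma eps) =
  amplitude j chi beta (- delta - 2 * beta) gamma eps.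
Proof.
apply/funext => A; apply/funext => -[[[z y] b] [P f]].
rewrite /query_fun /amplitude /= ffunE /=; congr (_ * (_ * (_ * _))).
rewrite /branch; case: f => //; rewrite [y == _]eq_sym.
case: eqP => [<-|_] /=; last by rewrite addbF !mulr0 !addr0.
by rewrite top_eq_refl addbT; case: b => /=; rewrite ?expr0 ?expr1; ring.
Qed.

Local Notation conv := (@convertible R X W mat c).

Lemma convertible_stage j chi beta delta gamma :
  (top_card j)%:R * beta ^+ 2 + 2 * beta * delta + delta ^+ 2 + gamma ^+ 2 <= 1 ->
  conv 1 (stage_gram j chi (delta ^+ 2 + gamma ^+ 2))
         (stage_gram j chi ((delta + 2 * beta) ^+ 2 + gamma ^+ 2)).
Proof.
rewrite -subr_ge0 => /sqr_sqrtr; set eps := Num.sqrt _ => norm.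
have h1 : (top_card j)%:R * beta ^+ 2 + 2 * beta * delta
    + delta ^+ 2 + gamma ^+ 2 + eps ^+ 2 = 1 by rewrite norm; ring.
have h2 : (top_card j)%:R * beta ^+ 2 + 2 * beta * (- delta - 2 * beta)
    + (- delta - 2 * beta) ^+ 2 + gamma ^+ 2 + eps ^+ 2 = 1 by rewrite norm; ring.
rewrite (_ : (delta + 2 * beta) ^+ 2 = (- delta - 2 * beta) ^+ 2); last by ring.
rewrite -(gram_amplitude chi h1) -(gram_amplitude chi h2) -query_amplitude.
exact: convertible1.
Qed.

(** * Schedule of the exact amplitude amplification *)

Section Schedule.
Variables (j : nat) (chi : mat -> 'cV['F_2]_l -> R) (T : nat).
Hypotheses (T_gt0 : (0 < T)%N) (T_large : (2 * top_card j <= T ^ 2)%N).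

Let N2T : 2 * (top_card j)%:R <= T%:R ^+ 2 :> R.
Proof. by rewrite -natrX -natrM ler_nat. Qed.

Let T0 : 0 < T%:R :> R. Proof. by rewrite ltr0n. Qed.

(* The first [T] steps raise [d] to [1/4] with [sqrt d] linear in time, the next
   [T] steps raise it to [1] with [sqrt (1 - d)] linear in time. *)
Lemma convertible_quarter t : (t <= T)%N ->
  conv t (stage_gram j chi 0) (stage_gram j chi ((t%:R / (2 * T%:R)) ^+ 2)).
Proof.
elim: t => [_|t IH tT]; first by rewrite /= mul0r expr0n.
have tT' : t%:R + 1 <= T%:R :> R by rewrite natr1 ler_nat.
have t0 : 0 <= t%:R :> R by [].
(* A query raises [delta] by [2 * beta], so this [beta] raises [sqrt d] by [1 / (2 T)]. *)
have := @convertible_stage j chi (4 * T%:R)^-1 (t%:R / (2 * T%:R)) 0.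
rewrite (_ : 0 ^+ 2 = 0 :> R) ?addr0 => [h|]; last by rewrite expr0n.
rewrite -[t.+1]addn1; apply: convertible_trans (IH (ltnW tT)) _.
rewrite (_ : (t + 1)%:R / (2 * T%:R) = t%:R / (2 * T%:R) + 2 * (4 * T%:R)^-1).
  apply: h; rewrite (_ : _ + _ = ((top_card j)%:R + 4 * t%:R + 4 * t%:R ^+ 2) / (16 * T%:R ^+ 2)); last first.
    by field; rewrite gt_eqF.
  rewrite ler_pdivrMr ?mul1r; last by rewrite mulr_gt0 // exprn_gt0.
  by move: N2T T0; nra.
by rewrite natrD; field; rewrite gt_eqF.
Qed.

Lemma convertible_rest t : (t <= T)%N ->
  conv t (stage_gram j chi (2^-1 ^+ 2))
         (stage_gram j chi (1 - 3 / 4 * ((T%:R - t%:R) / T%:R) ^+ 2)).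
Proof.
elim: t => [_|t IH tT].
  by rewrite /=; congr stage_gram; field; rewrite gt_eqF.
have tT' : t%:R + 1 <= T%:R :> R by rewrite natr1 ler_nat.
have t0 : 0 <= t%:R :> R by [].
rewrite -[t.+1]addn1; apply: convertible_trans (IH (ltnW tT)) _.
pose r : R := T%:R - t%:R; have r1 : 1 <= r by rewrite /r; lra.
have rT : r <= T%:R by rewrite /r; lra.
have -> : T%:R - (t + 1)%:R = r - 1 :> R by rewrite /r natrD; ring.
(* Moving [delta] from [1/2 - beta] to [1/2 + beta] raises [d] by [2 * beta], and [beta] is set so
   that this equals the scheduled increment [3/4 * (r ^+ 2 - (r - 1) ^+ 2) * u]. The rest of [d] is
   put into [gamma]. *)
rewrite -/r; pose u : R := T%:R ^- 2; pose beta := 3 / 8 * (2 * r - 1) * u.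
have u0 : 0 < u by rewrite invr_gt0 exprn_gt0.
have uT : u * T%:R ^+ 2 = 1 by rewrite mulVf // expf_neq0 // gt_eqF.
have Nu : (top_card j)%:R * u <= 1 / 2.
  by rewrite -(ler_pM2r (exprn_gt0 2 T0)) -mulrA uT; move: N2T; lra.
have ru : r ^+ 2 * u <= 1.
  by rewrite -uT mulrC ler_pM2l // lerXn2r // nnegrE; [lra | exact: ltW].
have dE (x : R) : (x / T%:R) ^+ 2 = x ^+ 2 * u by rewrite expr_div_n.
have b0 : 0 <= beta by rewrite !mulr_ge0 ?(ltW u0) //; lra.
have b1 : beta <= 3 / 8.
  rewrite /beta -mulrA -[X in _ <= X]mulr1 ler_pM2l; last lra.
  by apply: le_trans ru; rewrite ler_pM2r //; nra.
pose g := 1 - 3 / 4 * (r ^+ 2 * u) - (1 / 2 - beta) ^+ 2.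
have g0 : 0 <= g by rewrite /g; nra.
have := @convertible_stage j chi beta (1 / 2 - beta) (Num.sqrt g).
rewrite sqr_sqrtr // !dE => /(_ _) h.
rewrite (_ : 1 - 3 / 4 * (r ^+ 2 * u) = (1 / 2 - beta) ^+ 2 + g); last by rewrite /g; ring.
rewrite (_ : 1 - 3 / 4 * ((r - 1) ^+ 2 * u) = (1 / 2 - beta + 2 * beta) ^+ 2 + g); last first.
  by rewrite /g /beta; field.
(* With [N = top_card j] the norm condition becomes [N * beta ^+ 2 + beta - 2 * beta ^+ 2 <= 3/4 * r
   ^+ 2 * u]. As [N * u <= 1/2] and [r >= 1], the left side is also of order [r ^+ 2 * u]. *)
apply: h; rewrite /g.
have hN : (top_card j)%:R * beta ^+ 2 <= 9 / 128 * (2 * r - 1) ^+ 2 * u.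
  have -> : (top_card j)%:R * beta ^+ 2 =
      ((top_card j)%:R * u) * (9 / 64 * (2 * r - 1) ^+ 2 * u) by rewrite /beta; field.
  rewrite (_ : 9 / 128 * _ * u = 1 / 2 * (9 / 64 * (2 * r - 1) ^+ 2 * u)); last by field.
  apply: ler_wpM2r Nu; rewrite mulr_ge0 ?(ltW u0) // mulr_ge0 ?sqr_ge0 //; lra.
have hr : 0 <= (3 / 4 * r ^+ 2 - 9 / 128 * (2 * r - 1) ^+ 2 - 3 / 8 * (2 * r - 1)) * u.
  by apply: mulr_ge0; [nra | exact: ltW].
have hb : 0 <= beta ^+ 2 by exact: sqr_ge0.
have bE : beta = 3 / 8 * (2 * r - 1) * u by [].
by clearbody beta; move: hN hr hb bE; lra.
Qed.

Lemma convertible_search : conv (2 * T) (stage_gram j chi 0) (stage_gram j chi 1).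
Proof.
rewrite mul2n -addnn; apply: convertible_trans (convertible_quarter (leqnn T)) _.
have -> : T%:R / (2 * T%:R) = 2^-1 :> R by field; rewrite gt_eqF.
by have := convertible_rest (leqnn T); rewrite subrr mul0r expr0n /= mulr0 subr0.
Qed.
End Schedule.

(** * Phase of one row and recursion over the rows *)

Definition row_sign (j : 'I_m) (A : mat) (z : 'cV['F_2]_l) : R :=
  (-1) ^+ ((A *m z) j 0 != 0).

(** Orthogonality of characters: translating [z] by a unit vector at a column where the rows differ
    flips the sign of every term. *)
Lemma sum_row_sign (j : 'I_m) (A B : mat) : row j A != row j B ->
  \sum_z row_sign j A z * row_sign j B z = 0.
Proof.
move=> AB; have [k ABk] : exists k, A j k != B j k.
  apply/existsP; rewrite -negb_forall; apply: contra AB => /forallP h.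
  by apply/eqP/rowP => k; rewrite !mxE; apply/eqP.
set S := \sum_z _; suff : S = - S by lra.
rewrite {1}/S (reindex (fun z => z + delta_mx k 0)) /=; last first.
  by apply/onW_bij; exists (fun y => y - delta_mx k 0) => y; rewrite ?addrK ?subrK.
rewrite /S -sumrN; apply: eq_bigr => z _.
have e (C : mat) : (C *m (z + delta_mx k 0)) j 0 = (C *m z) j 0 + C j k.
  by rewrite mulmxDr -colE mxE [in X in _ + X]mxE.
rewrite /row_sign !e.
rewrite -!signr_addb -signrN.
congr (_ ^+ (nat_of_bool _)).
move: ABk; move: ((A *m z) j 0) ((B *m z) j 0) (A j k) (B j k).
by move=> [[|[|?]] ?] [[|[|?]] ?] [[|[|?]] ?] [[|[|?]] ?].
Qed.

(** Once [A *m z] is fully computed the phase is free: pairs with different images contribute 0, the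
    others carry equal signs. *)
Lemma stage_gram_sign (j : 'I_m) :
  stage_gram j (row_sign j) 1 = stage_gram j (fun _ _ => 1) 1.
Proof.
apply/funext => A; apply/funext => B; congr (_ * (_ * _)); apply: eq_bigr => z _.
rewrite mul1r; case: eqP => [AB|]; last by rewrite subrr !mulr0.
by rewrite /row_sign AB -signr_addb addbb !mulr1.
Qed.

Lemma top_rowsS (j : 'I_m) (A B : mat) :
  (top_rows j.+1 A == top_rows j.+1 B) =
  (top_rows j A == top_rows j B) && (row j A == row j B).
Proof.
apply/eqP/andP => [/matrixP h|[/eqP/matrixP h /eqP/rowP h']].
  split; apply/eqP.
    by apply/matrixP => i k; have := h i k; rewrite !mxE ltnS; case: (ltngtP i j).
  by apply/rowP => k; have := h j k; rewrite !mxE ltnSn.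
apply/matrixP => i k; have := h i k; have := h' k; rewrite !mxE ltnS.
by case: ltngtP => // /val_inj ->.
Qed.

(** After uncomputation the signed states coincide or are orthogonal according to whether the rows
    [j] agree, exactly as if row [j] had been stored. *)
Lemma stage_gram_next (j : 'I_m) :
  stage_gram j (row_sign j) 0 = stage_gram j.+1 (fun _ _ => 1) 0.
Proof.
apply/funext => A; apply/funext => B; rewrite /stage_gram top_rowsS.
case: eqP => _ /=; last by rewrite !mul0r.
under eq_bigr do rewrite mul0r subr0 mulr1.
under [in RHS]eq_bigr do rewrite mul0r subr0 !mulr1.
have [AB|AB] := eqVneq (row j A) (row j B); last by rewrite sum_row_sign // mulr0 !mul0r mulr0.
congr (_ * (_ * _)); apply: eq_bigr => z _.
rewrite /row_sign (_ : (A *m z) j 0 = (B *m z) j 0); first by rewrite -signr_addb addbb.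
by move/rowP: AB => AB; rewrite !mxE; apply: eq_bigr => k _; have := AB k; rewrite !mxE => ->.
Qed.

Lemma convertible_next (j : 'I_m) :
  conv (8 * 2 ^ ((m - j)./2)) (stage_gram j (fun _ _ => 1) 0)
       (stage_gram j.+1 (fun _ _ => 1) 0).
Proof.
(* The extra factor 2 covers both the rounding of [(m - j) / 2] and the factor 2 in
   [2 * top_card j <= T ^ 2]. Search and uncomputation take [2 * T] queries each. *)
set T := (2 ^ ((m - j)./2).+1)%N.
have T0 : (0 < T)%N by rewrite expn_gt0.
have TN : (2 * top_card j <= T ^ 2)%N.
  apply: (@leq_trans (2 * 2 ^ (m - j))).
    by rewrite leq_mul2l top_card_le // ltnW.
  by rewrite -expnS /T -expnM leq_exp2l //; lia.
rewrite (_ : 8 * _ = 2 * T + 2 * T)%N; last by rewrite /T expnS; lia.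
apply: convertible_trans (convertible_search (fun _ _ => 1) T0 TN) _.
rewrite -stage_gram_sign -stage_gram_next; apply: convertible_sym.
exact: convertible_search.
Qed.

(* Solves [cost k.+1 = cost k + 8 * 2 ^ k.+1./2]. *)
Let cost (k : nat) : nat := 2 ^ k./2 * (24 + 8 * odd k).

(** The unspent budget [cost (m - j)] is carried along, so the geometric series is never summed. *)
Lemma convertible_prefix j : (j <= m)%N ->
  exists2 q, (q + cost (m - j) <= cost m)%N &
  conv q (stage_gram 0 (fun _ _ => 1) 0) (stage_gram j (fun _ _ => 1) 0).
Proof.
elim: j => [_|j IH jm]; first by exists 0; rewrite ?subn0.
have [q qm hq] := IH (ltnW jm); exists (q + 8 * 2 ^ ((m - j)./2))%N; last first.
  by apply: convertible_trans hq (convertible_next (Ordinal jm)).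
apply: leq_trans qm; rewrite -addnA leq_add2l.
have [k kE] : exists k, (m - j = k.+1)%N by exists (m - j).-1; rewrite prednK // subn_gt0.
have -> : (m - j.+1 = k)%N by lia.
rewrite kE /cost /= uphalf_half; case: (odd k); rewrite ?add1n ?add0n ?expnS /=; lia.
Qed.

(** With no rows stored all targets share one state; with all [m] rows stored their states are
    orthonormal. *)
Lemma quantum_learnable_ub :
  exists2 q, (q <= 32 * 2 ^ (m./2))%N & quantum_learnable R (lin_class l m) q.
Proof.
have [q qm hq] := convertible_prefix (leqnn m).
exists q.
  apply: leq_trans (leq_addr _ _) (leq_trans qm _).
  by rewrite /cost mulnC leq_mul2r; case: (odd m); rewrite ?orbT.
have G0 : stage_gram 0 (fun _ _ => 1) 0 = fun _ _ => 1.
  apply/funext => A; apply/funext => B; rewrite /stage_gram.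
  rewrite (_ : top_rows 0 A == top_rows 0 B); last by apply/eqP/matrixP => i k; rewrite !mxE.
  under eq_bigr do rewrite mul0r subr0 !mulr1.
  rewrite sumr_const card_mx card_Fp // muln1 natrX mulVf ?mulr1 //.
have Gm : stage_gram m (fun _ _ => 1) 0 = fun A B => (A == B)%:R.
  apply/funext => A; apply/funext => B; rewrite /stage_gram.
  have -> : (top_rows m A == top_rows m B) = (A == B).
    have e (C : mat) : top_rows m C = C by apply/matrixP => i k; rewrite !mxE ltn_ord.
    by rewrite !e.
  under eq_bigr do rewrite mul0r subr0 !mulr1.
  rewrite sumr_const card_mx card_Fp // muln1 natrX mulVf ?mulr1 //.
rewrite G0 Gm in hq.
have [L hL] := @learner_of_convertible R X W mat c q ((0, 0), false, (0, false))
  (fun A => ((0, 0), false, (A, false))) (@lin_concept_inj l m) (fun A B e => congr1 (fun x => x.2.1) e) hq.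
exists L => _ /imsetP[A _ ->]; apply: le_trans (hL A).
by rewrite ler_pdivrMr // mul1r ler_nat.
Qed.
End LinearLearner.

(** * Complexity bounds *)

Lemma min_queries_ge (R : realType) (P : nat -> Prop) (x : R) :
  (forall q, P q -> x <= q%:R) -> (x%:E <= min_queries R P)%E.
Proof.
by move=> xP; apply/ereal_infP => _ [q /= Pq <-]; rewrite lee_fin xP.
Qed.

Lemma min_queries_le (R : realType) (P : nat -> Prop) (q : nat) (x : R) :
  P q -> q%:R <= x -> (min_queries R P <= x%:E)%E.
Proof.
move=> Pq qx; apply: (@le_trans _ _ (q%:R)%:E); last by rewrite lee_fin.
by apply: ereal_inf_lbound; exists q.
Qed.

Lemma powR_half_sqr (R : realType) (m : nat) : (2 `^ (m%:R / 2) : R) ^+ 2 = 2 ^+ m.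
Proof.
by rewrite -powR_mulrn ?powR_ge0 // -powRrM divfK ?pnatr_eq0 // powR_mulrn.
Qed.

Lemma quantum_complexity_bounds (R : realType) (l m : nat) : (1 <= l)%N -> (1 <= m)%N ->
  ((20^-1 * 2 `^ (m%:R / 2))%:E <= quantum_complexity R (lin_class l m))%E /\
  (quantum_complexity R (lin_class l m) <= (32 * 2 `^ (m%:R / 2))%:E)%E.
Proof.
move=> l1 m1; have p2 := powR_half_sqr R m; set p := _ `^ _ in p2 *.
have p0 : 0 <= p by exact: powR_ge0.
split.
  apply: min_queries_ge => q /(quantum_learnable_lb l1 m1).
  rewrite -(ler_nat R) natrM !natrX -p2 => hq.
  (* The constant 20 works because 336 is at most 20 squared. *)
  rewrite mulrC ler_pdivrMr // -(@ler_pXn2r _ 2) ?nnegrE ?mulr_ge0 //.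
  by apply: le_trans hq _; rewrite exprMn mulrC ler_wpM2l ?exprn_ge0 // -natrX ler_nat.
have [q hq /min_queries_le] := quantum_learnable_ub R l m; apply.
apply: (@le_trans _ _ (32 * 2 ^+ m./2)); first by rewrite -natrX -natrM ler_nat.
rewrite ler_pM2l // -(@ler_pXn2r _ 2) ?nnegrE ?exprn_ge0 // p2 -exprM ler_weXn2l ?ler1n //.
by rewrite muln2 -[X in (_ <= X)%N]odd_double_half leq_addl.
Qed.

(** The constant is relaxed from 1/10 to 1/20 so that one [kappa] serves both lower bounds. *)
Lemma rand_complexity_ge (R : realType) (l m : nat) : (1 <= l)%N -> (1 <= m)%N ->
  ((20^-1 * 2 ^+ m * l%:R)%:E <= rand_complexity R (lin_class l m))%E.
Proof.
move=> l1 m1; apply: min_queries_ge => q /(rand_learnable_lb l1 m1); apply: le_trans.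
rewrite -!mulrA ler_wpM2r ?mulr_ge0 ?exprn_ge0 // lef_pV2 ?posrE ?ltr0n //.
by rewrite ler_nat.
Qed.

Lemma card_lin_domain (m : nat) : #|lin_domain m m| = (2 ^ (2 * m))%N.
Proof. by rewrite card_prod !card_mx card_Fp // !muln1 -expnD addnn mul2n. Qed.

Theorem mainTheorem7 (R : realType) :
  (exists kappa K : R, [/\ 0 < kappa, 0 < K &
     forall l m : nat, (1 <= l)%N -> (1 <= m)%N ->
       [/\ ((kappa * 2 `^ (m%:R / 2))%:E <= quantum_complexity R (lin_class l m))%E,
           (quantum_complexity R (lin_class l m) <= (K * 2 `^ (m%:R / 2))%:E)%E &
           ((kappa * 2 ^+ m * l%:R)%:E <= rand_complexity R (lin_class l m))%E]])
  /\
  (forall m : nat, (1 <= m)%N -> #|lin_domain m m| = (2 ^ (2 * m))%N)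
  /\
  (exists kappa' : R, 0 < kappa' /\
     forall m : nat, (1 <= m)%N ->
       (kappa'%:E * quantum_complexity R (lin_class m m) ^+ 2
          * (log2 (#|lin_domain m m|%:R : R))%:E
        <= rand_complexity R (lin_class m m))%E).
Proof.
split; [|split].
- exists 20^-1, 32; split=> [||l m l1 m1]; rewrite ?invr_gt0 ?ltr0n //.
  have [lb ub] := quantum_complexity_bounds R l1 m1.
  by split=> //; exact: rand_complexity_ge.
- by move=> m _; exact: card_lin_domain.
(* Here 32 is the constant of the quantum upper bound, and 40 is 20 from the randomized bound times
   2 from [log N = 2 m]. *)
exists (40 * 32 ^+ 2)^-1; split=> [|m m1].
  by rewrite invr_gt0 mulr_gt0 ?exprn_gt0 ?ltr0n.
apply: le_trans (rand_complexity_ge R m1 m1).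
have [] := quantum_complexity_bounds R m1 m1.
(* The two quantum bounds exclude both infinite values. *)
case: (quantum_complexity R (lin_class m m)) => [r| |]; rewrite ?leey ?leNye //.
rewrite !lee_fin => lb ub.
have p0 : 0 <= 2 `^ (m%:R / 2) :> R by exact: powR_ge0.
have r0 : 0 <= r by apply: le_trans lb; rewrite mulr_ge0 ?invr_ge0.
have r2 : r ^+ 2 <= 32 ^+ 2 * 2 ^+ m.
  rewrite -powR_half_sqr; apply: (@le_trans _ _ ((32 * 2 `^ (m%:R / 2)) ^+ 2)).
    by rewrite lerXn2r // nnegrE mulr_ge0.
  by rewrite exprMn.
have -> : log2 (#|lin_domain m m|%:R : R) = 2 * m%:R.
  rewrite card_lin_domain natrX /log2 lnXn // -[ln _ *+ _]mulr_natl mulfK.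
    by rewrite natrM.
  by rewrite gt_eqF // ln_gt0 // ltr1n.
rewrite -expr2.
have -> : 20^-1 * 2 ^+ m * m%:R = (40 * 32 ^+ 2)^-1 * (32 ^+ 2 * 2 ^+ m) * (2 * m%:R) :> R by field.
by rewrite ler_wpM2r ?mulr_ge0 // ler_wpM2l ?invr_ge0 ?mulr_ge0 ?exprn_ge0.
Qed.
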